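(* Let $0<m\le L$. For an algorithm $\mathcal{A}$ in the class of linear time-invariant finite-state algorithms described in the context, let $\rho_{\mathrm{sec}}(\mathcal{A})$ be the best worst-case convergence rate certifiable using only the sector IQCs, i.e. the infimum of all $\rho>0$ for which there exist a symmetric $P\succ 0$ and $\lambda_1,\lambda_2\ge 0$ with $$\begin{bmatrix}A^\top PA-\rho^2P&A^\top PB\\ B^\top PA&B^\top PB\end{bmatrix}+\begin{bmatrix}C&0\\0&1\end{bmatrix}^\top\left(\lambda_1\begin{bmatrix}L^2&0\\0&-1\end{bmatrix}+\lambda_2\begin{bmatrix}-2m&1\\1&0\end{bmatrix}\right)\begin{bmatrix}C&0\\0&1\end{bmatrix}\preceq 0,$$ where $(A,B,C)$ is the state-space realization of $\mathcal{A}$ (with $\rho_{\mathrm{sec}}(\mathcal{A})=+\infty$ if no such $\rho$ exists). Then the smallest value of $\rho_{\mathrm{sec}}$ over the whole class is achieved by the gradient method $z_{k+1}=z_k-\eta F_k(z_k)$ with step size $\eta=m/L^2$; that is, $\rho_{\mathrm{sec}}(\mathrm{GD}_{m/L^2})\le\rho_{\mathrm{sec}}(\mathcal{A})$ for every algorithm $\mathcal{A}$ in the class.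
   Context: Sector IQCs: for possibly time-varying vector fields $F_k$, each $m$-strongly monotone and $L$-Lipschitz, with $e_k=F_k(y_k)$ and fixed point $(y^*,e^* )$, they are the inequalities $L^2\|y_k-y^*\|_2^2-\|e_k-e^*\|_2^2\ge 0$ and $(y_k-y^* )^\top\big((e_k-e^* )-m(y_k-y^* )\big)\ge 0$. Feasibility of the displayed matrix inequality certifies convergence at rate $\rho$ with a quadratic Lyapunov function when only these inequalities are used. Class of algorithms: the algorithm is a linear time-invariant system $K$ with a finite but arbitrary number $n_K\ge 0$ of states, in series with a pure integrator and in feedback with $F_k$: $$w_{k+1}=w_k+e_k,\qquad q_{k+1}=A_Kq_k+B_Kw_k,\qquad y_k=C_Kq_k+D_Kw_k,\qquad e_k=F_k(y_k),$$ where, without loss of generality, the system is written as single-input single-output (each matrix stands for its Kronecker product with $\mathbf{I}_d$): $w_k\in\mathbb{R}$, $q_k\in\mathbb{R}^{n_K}$, and $A_K,B_K,C_K,D_K$ are arbitrary real matrices of compatible sizes. Its realization with state $(q_k,w_k)$ is $$A=\begin{bmatrix}A_K&B_K\\0&1\end{bmatrix},\qquad B=\begin{bmatrix}0\\1\end{bmatrix},\qquad C=\begin{bmatrix}C_K&D_K\end{bmatrix}.$$ The gradient method with step size $\eta$, denoted $\mathrm{GD}_\eta$, is the member with $n_K=0$ and $D_K=-\eta$ (so $y_k=-\eta w_k=z_k$). *)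

(* Defs.v *)
(* MathComp / MathComp-Analysis. *)
From mathcomp Require Import all_boot all_order all_algebra.
From mathcomp Require Import all_classical all_reals all_analysis.

Set Implicit Arguments.
Unset Strict Implicit.
Unset Printing Implicit Defensive.

Import Order.TTheory GRing.Theory Num.Theory.
Local Open Scope classical_set_scope.
Local Open Scope ring_scope.

Definition posdefmx (R : realType) (n : nat) (P : 'M[R]_n) : Prop :=
  P^T = P /\ forall x : 'cV[R]_n, x != 0 -> 0 < (x^T *m P *m x) 0 0.

Definition negsemidefmx (R : realType) (n : nat) (M : 'M[R]_n) : Prop :=
  M^T = M /\ forall x : 'cV[R]_n, (x^T *m M *m x) 0 0 <= 0.

(* The linear time-invariant part K of the algorithm; the integrator
   w_{k+1} = w_k + e_k in series with it is added by realA and realB below. *)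
Record algorithm (R : realType) := Algorithm {
  nK : nat;
  AK : 'M[R]_nK;
  BK : 'cV[R]_nK;
  CK : 'rV[R]_nK;
  DK : R }.

Section Algorithm.
Variable R : realType.
Implicit Types alg : algorithm R.

(* Realization with state (q_k, w_k). *)
Definition realA alg : 'M[R]_(nK alg + 1) :=
  block_mx (AK alg) (BK alg) 0 1%:M.

Definition realB alg : 'cV[R]_(nK alg + 1) := col_mx 0 1%:M.

Definition realC alg : 'rV[R]_(nK alg + 1) := row_mx (CK alg) (DK alg)%:M.

Definition GD (eta : R) : algorithm R :=
  @Algorithm R 0%N 0 0 0 (- eta).

Definition trajectory alg (F : nat -> R -> R)
    (x : nat -> 'cV[R]_(nK alg + 1)) (y : nat -> R) : Prop :=
  forall k, x k.+1 = realA alg *m x k + F k (y k) *: realB alg /\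
            y k = (realC alg *m x k) 0 0.

(* The output of GD eta follows the gradient method driven by F. *)
Lemma GD_trajectory (eta : R) (F : nat -> R -> R)
    (x : nat -> 'cV[R]_(nK (GD eta) + 1)) (y : nat -> R) :
  trajectory F x y -> forall k, y k.+1 = y k - eta * F k (y k).
Proof.
move=> h k; have [xS yk] := h k; have [_ ->] := h k.+1; rewrite xS.
have A1 : realA (GD eta) = 1%:M.
  by rewrite /realA [RHS]scalar_mx_block; congr (block_mx _ _ _ _);
    apply/matrixP => - [].
have CB : realC (GD eta) *m realB (GD eta) = (- eta)%:M.
  by rewrite mul_row_col mulmx0 add0r mulmx1.
rewrite A1 mul1mx mulmxDr -scalemxAr CB mxE -yk !mxE eqxx mulr1n.
by rewrite mulrN mulrC.
Qed.

(* First block: the increment x_{k+1}^T P x_{k+1} - rho^2 x_k^T P x_k as a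
   quadratic form in (x_k, e_k). *)
Definition lyapunov_mx alg (rho : R) (P : 'M[R]_(nK alg + 1)) :
    'M[R]_(nK alg + 1 + 1) :=
  let A := realA alg in let B := realB alg in
  block_mx (A^T *m P *m A - rho ^+ 2 *: P) (A^T *m P *m B)
           (B^T *m P *m A)                 (B^T *m P *m B).

(* Maps (x_k, e_k) to (y_k, e_k). *)
Definition output_mx alg : 'M[R]_(1 + 1, nK alg + 1 + 1) :=
  block_mx (realC alg) 0 0 1%:M.

Definition lipschitz_iqc (L : R) : 'M[R]_(1 + 1) :=
  block_mx (L ^+ 2)%:M 0 0 (- 1)%:M.

Definition monotone_iqc (m : R) : 'M[R]_(1 + 1) :=
  block_mx (- (2 * m))%:M 1%:M 1%:M 0.

Definition sector_lmi (m L : R) alg (rho : R) (P : 'M[R]_(nK alg + 1))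
    (lambda1 lambda2 : R) : 'M[R]_(nK alg + 1 + 1) :=
  lyapunov_mx rho P +
  (output_mx alg)^T
    *m (lambda1 *: lipschitz_iqc L + lambda2 *: monotone_iqc m)
    *m output_mx alg.

Definition sector_certifies (m L : R) alg (rho : R) : Prop :=
  exists (P : 'M[R]_(nK alg + 1)) (lambda1 lambda2 : R),
    [/\ posdefmx P, 0 <= lambda1, 0 <= lambda2 &
        negsemidefmx (sector_lmi m L rho P lambda1 lambda2)].

(* An extended real: the infimum of the empty set is +oo. *)
Definition rho_sec (m L : R) alg : \bar R :=
  ereal_inf [set rho%:E | rho in
    [set rho : R | 0 < rho /\ sector_certifies m L alg rho]].

End Algorithm.

(* Main.v *)
Require Import Defs.
From mathcomp Require Import all_boot all_order all_algebra.
From mathcomp Require Import all_classical all_reals all_analysis.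
From mathcomp Require Import ring lra.
Import Order.TTheory GRing.Theory Num.Theory.
Local Open Scope ring_scope.

(** A certificate with multipliers [lambda1], [lambda2] uses the two sector
    constraints only through their weighted sum, which (with
    [c = lambda2 / lambda1]) confines a complex gain [e / y] to the disc with
    centre [c] and squared radius [r2 = L^2 - 2 m c + c^2].  In the frequency
    domain the optimum over all algorithms is then a Schwarz lemma: the
    integrator forces the transfer function around the centre to equal [-1/c]
    at [z = 1], strict causality forces it to vanish at infinity, and the
    certificate bounds it by [1 / r] outside the disc of radius [rho]; hence
    [r <= rho c].  Minimizing [r2 / c^2] over [c] gives
    [rho^2 >= 1 - m^2 / L^2], with equality at [c = L^2 / m].

    This Schwarz lemma is elementary; only [rho < 1] matters.  The integrator
    gives a nonzero equilibrium [u], [A u = u], of the undriven system.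
    Evaluating the matrix inequality at [(u, 0)], and at [(u, c y)] where
    [y = C u], bounds the Lyapunov value of [u] from above and from below by multiples of [y^2]
    ([certified_rate_ge]); comparing the two bounds is the inequality
    [r <= rho c].  Conversely, for the gradient method with step [m / L^2] the
    matrix inequality, with [P] the identity, reduces to
    [rho^2 >= 1 - m^2 / L^2] ([gradient_certifies]).  So every rate
    certified for some algorithm is certified for this gradient method. *)

Set Implicit Arguments.
Unset Strict Implicit.

Section SectorCertificates.
(* [Num.Theory] also has a [realA]. *)
Import Defs.
Variable R : realType.
Implicit Types alg : algorithm R.

Definition qform n (M : 'M[R]_n) (x : 'cV[R]_n) : R := (x^T *m M *m x) 0 0.

Lemma qform_add n (M N : 'M[R]_n) x : qform (M + N) x = qform M x + qform N x.
Proof. by rewrite /qform mulmxDr mulmxDl mxE. Qed.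

Lemma qform_scale n a (M : 'M[R]_n) x : qform (a *: M) x = a * qform M x.
Proof. by rewrite /qform -scalemxAr -scalemxAl mxE. Qed.

Lemma qform_congr n p (M : 'M[R]_n) (T : 'M[R]_(n, p)) x :
  qform (T^T *m M *m T) x = qform M (T *m x).
Proof. by rewrite /qform trmx_mul !mulmxA. Qed.

Lemma qform_lipschitz L (y e : R) :
  qform (lipschitz_iqc L) (col_mx y%:M e%:M) = L ^+ 2 * y ^+ 2 - e ^+ 2.
Proof.
rewrite /qform /lipschitz_iqc -mulmxA mul_block_col tr_col_mx mul_row_col.
rewrite !mul0mx addr0 add0r !tr_scalar_mx -!scalar_mxM !mxE /= !mulr1n.
by ring.
Qed.

Lemma qform_monotone m (y e : R) :
  qform (monotone_iqc m) (col_mx y%:M e%:M) = 2 * y * e - 2 * m * y ^+ 2.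
Proof.
rewrite /qform /monotone_iqc -mulmxA mul_block_col tr_col_mx mul_row_col.
rewrite !mul0mx addr0 !tr_scalar_mx !mul1mx mulmxDr -!scalar_mxM.
rewrite !mxE /= !mulr1n.
by ring.
Qed.

Lemma lyapunov_mxE alg rho (P : 'M[R]_(nK alg + 1)) :
  lyapunov_mx rho P =
    (row_mx (realA alg) (realB alg))^T *m P *m row_mx (realA alg) (realB alg)
    + (- rho ^+ 2) *: ((row_mx 1%:M 0)^T *m P *m row_mx 1%:M 0).
Proof.
rewrite !tr_row_mx !(mul_col_mx _ _ P) !mul_col_row trmx1 trmx0 !mul1mx !mul0mx.
rewrite !mulmx0 mulmx1 scale_block_mx add_block_mx !scaler0 !addr0.
by rewrite scaleNr.
Qed.

(** The inequality that the matrix condition imposes on one step of the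
    algorithm with state [x] and feedback value [e]. *)
Lemma qform_sector_lmi m L alg rho (P : 'M[R]_(nK alg + 1)) l1 l2 x (e : R) :
  let y := (realC alg *m x) 0 0 in
  qform (sector_lmi m L rho P l1 l2) (col_mx x e%:M) =
    qform P (realA alg *m x + e *: realB alg) - rho ^+ 2 * qform P x
    + l1 * (L ^+ 2 * y ^+ 2 - e ^+ 2) + l2 * (2 * y * e - 2 * m * y ^+ 2).
Proof.
move=> y; rewrite /sector_lmi lyapunov_mxE !qform_add qform_scale !qform_congr.
rewrite !mul_row_col mul_mx_scalar mul1mx mul0mx addr0.
rewrite mul_block_col !mul0mx addr0 add0r mul1mx (mx11_scalar (realC alg *m x)).
rewrite qform_add !qform_scale qform_lipschitz qform_monotone -/y.
by ring.
Qed.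

Lemma sector_lmi_sym m L alg rho (P : 'M[R]_(nK alg + 1)) l1 l2 :
  P^T = P -> (sector_lmi m L rho P l1 l2)^T = sector_lmi m L rho P l1 l2.
Proof.
move=> PT.
have congrT n p (M : 'M[R]_n) (T : 'M[R]_(n, p)) :
    M^T = M -> (T^T *m M *m T)^T = T^T *m M *m T.
  by move=> MT; rewrite !trmx_mul trmxK MT mulmxA.
rewrite /sector_lmi lyapunov_mxE; set N := l1 *: _ + _.
have NT : N^T = N.
  by rewrite /N linearD !linearZ /= !tr_block_mx !tr_scalar_mx !trmx0.
by rewrite [LHS]linearD [X in X + _]linearD linearZ /= !congrT.
Qed.

(** The integrator makes the last row of [A - 1] vanish, so [1] is an
    eigenvalue of [A] whatever the linear part [K] is. *)
Lemma integrator_equilibrium alg :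
  exists2 u : 'cV[R]_(nK alg + 1), u != 0 & realA alg *m u = u.
Proof.
have : \det ((realA alg - 1%:M)^T) == 0.
  rewrite det_tr scalar_mx_block opp_block_mx add_block_mx !subr0 subrr.
  by rewrite det_ublock det_mx11 mxE mulr0.
move/det0P => [v v0 Av]; exists v^T; first by rewrite trmx_eq0.
apply/eqP; rewrite -subr_eq0 -{2}(mul1mx v^T) -mulmxBl.
by rewrite -[_ - _]trmxK -trmx_mul Av trmx0.
Qed.

(** With [V] the Lyapunov value of the equilibrium and [y] its output, the
    hypotheses are the matrix inequality at the points with feedback [0] and
    [c y].  They give [r2 <= rho^2 c^2] after elimination of [V / y^2], and
    the conclusion is then [(m c - L^2)^2 >= 0]. *)
Lemma rate_ge_of_equilibrium_bounds (m L rho l c V y : R) :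
  0 < m -> 0 < L -> 0 < l -> 0 < V -> 0 <= c -> rho ^+ 2 < 1 ->
  (1 - rho ^+ 2) * V <= l * (2 * m * c - L ^+ 2) * y ^+ 2 ->
  l * (L ^+ 2 - 2 * m * c + c ^+ 2) * y ^+ 2 <= rho ^+ 2 * V ->
  1 - m ^+ 2 / L ^+ 2 <= rho ^+ 2.
Proof.
move=> m0 L0 l0 V0 c0 rho1 upper lower.
have L20 : 0 < L ^+ 2 by rewrite exprn_gt0.
have ly0 : 0 < l * y ^+ 2.
  rewrite pmulr_rgt0 // lt0r sqr_ge0 andbT; apply/negP => /eqP y0.
  by move: upper; rewrite y0 mulr0 leNgt mulr_gt0 ?subr_gt0.
have c_gt0 : 0 < c.
  rewrite lt0r c0 andbT; apply/negP => /eqP cE.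
  have : 0 < (1 - rho ^+ 2) * V by rewrite mulr_gt0 ?subr_gt0.
  have : 0 < L ^+ 2 * (l * y ^+ 2) by rewrite mulr_gt0.
  by rewrite cE in upper; lra.
have radius_le : L ^+ 2 - 2 * m * c + c ^+ 2 <= rho ^+ 2 * c ^+ 2.
  have up := ler_wpM2l (sqr_ge0 rho) upper.
  have rho1' : 0 <= 1 - rho ^+ 2 by rewrite subr_ge0 ltW.
  have lo := ler_wpM2l rho1' lower.
  rewrite -(ler_pM2l ly0); lra.
have c20 : 0 < c ^+ 2 by rewrite exprn_gt0.
rewrite lerBlDr -lerBlDl ler_pdivlMr // -(ler_pM2l c20).
have sq := sqr_ge0 (m * c - L ^+ 2).
have := ler_wpM2l (ltW L20) radius_le.
by move: sq; lra.
Qed.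

Lemma certified_rate_ge m L alg rho :
  0 < m -> 0 < L -> sector_certifies m L alg rho ->
  1 - m ^+ 2 / L ^+ 2 <= rho ^+ 2.
Proof.
move=> m0 L0 [P [l1 [l2 [[_ Ppos] l1_ge0 l2_ge0 [_ lmi_le0]]]]].
have step x e : qform (sector_lmi m L rho P l1 l2) (col_mx x e%:M) <= 0.
  exact: lmi_le0.
have P_ge0 x : 0 <= qform P x.
  have [->|/Ppos/ltW//] := eqVneq x 0.
  by rewrite /qform mulmx0 mxE.
(* A unit impulse from the zero state: lambda1 dominates the value of B. *)
have l1_gt0 : 0 < l1.
  have B0 : realB alg != 0.
    by rewrite /realB col_mx_eq0 eqxx /= oner_eq0.
  have := step 0 1; rewrite qform_sector_lmi !mulmx0 scale1r add0r mxE.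
  have -> : qform P 0 = 0 by rewrite /qform mulmx0 mxE.
  by have := Ppos _ B0; rewrite -/(qform P _); lra.
have [rho1|rho1] := leP 1 (rho ^+ 2).
  by apply: le_trans rho1; rewrite gerBl divr_ge0 ?sqr_ge0.
have [u u0 Au] := integrator_equilibrium alg.
set y := (realC alg *m u) 0 0.
have l2E : l2 = l1 * (l2 / l1) by rewrite mulrC divfK ?gt_eqF.
set c := l2 / l1 in l2E.
apply: (@rate_ge_of_equilibrium_bounds m L rho l1 c (qform P u) y) => //.
- exact: Ppos.
- by rewrite divr_ge0.
- have := step u 0; rewrite qform_sector_lmi Au scale0r addr0 -/y l2E.
  by lra.
- have := step u (c * y); rewrite qform_sector_lmi -/y l2E.
  by have := P_ge0 (realA alg *m u + (c * y) *: realB alg); lra.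
Qed.

(** For step [eta = m / L^2] the multipliers are [lambda1 = 1] and
    [lambda2 = 1 / eta]: they cancel the [e^2] and [w e] terms, leaving
    [1 - m^2 / L^2 - rho^2] times [w^2]. *)
Lemma gradient_certifies (m L rho : R) :
  0 < m -> 0 < L -> 1 - m ^+ 2 / L ^+ 2 <= rho ^+ 2 ->
  sector_certifies m L (GD (m / L ^+ 2)) rho.
Proof.
move=> m0 L0 rate; set alg := GD (m / L ^+ 2).
have sq_norm (x : 'cV[R]_(nK alg + 1)) : qform 1%:M x = dsubmx x 0 0 ^+ 2.
  rewrite /qform mulmx1 -[x in LHS]vsubmxK tr_col_mx mul_row_col.
  rewrite [usubmx x]flatmx0 mulmx0 add0r [dsubmx x in LHS]mx11_scalar.
  by rewrite tr_scalar_mx -scalar_mxM mxE mulr1n.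
exists 1%:M, 1, (L ^+ 2 / m); split => //.
- split; first exact: trmx1.
  move=> x x0; rewrite -/(qform _ x) sq_norm lt0r sqr_ge0 andbT sqrf_eq0.
  apply: contra x0 => /eqP w0.
  by rewrite -[x]vsubmxK [usubmx x]flatmx0 [dsubmx x]mx11_scalar w0 raddf0 col_mx0.
- by rewrite divr_ge0 ?sqr_ge0 ?ltW.
split; first by apply: sector_lmi_sym; exact: trmx1.
move=> x; rewrite -/(qform _ x) -[x]vsubmxK [dsubmx x]mx11_scalar.
set e := dsubmx x 0 0; set s := usubmx x.
rewrite qform_sector_lmi !sq_norm; set w := dsubmx s 0 0.
have -> : dsubmx (realA alg *m s + e *: realB alg) 0 0 = w + e.
  rewrite -[s]vsubmxK mul_block_col scale_col_mx add_col_mx col_mxKd.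
  by rewrite mul0mx add0r mul1mx mxE -/w; congr (_ + _); rewrite !mxE mulr1.
have -> : (realC alg *m s) 0 0 = - (m / L ^+ 2) * w.
  rewrite -[s]vsubmxK mul_row_col mul0mx add0r.
  by rewrite mul_scalar_mx mxE.
have -> : (w + e) ^+ 2 - rho ^+ 2 * w ^+ 2 +
    1 * (L ^+ 2 * (- (m / L ^+ 2) * w) ^+ 2 - e ^+ 2) +
    L ^+ 2 / m * (2 * (- (m / L ^+ 2) * w) * e -
                  2 * m * (- (m / L ^+ 2) * w) ^+ 2)
  = (1 - m ^+ 2 / L ^+ 2 - rho ^+ 2) * w ^+ 2.
  by field; rewrite !gt_eqF.
by rewrite mulr_le0_ge0 ?sqr_ge0 // subr_le0.
Qed.

End SectorCertificates.

Theorem theorem2 (R : realType) (m L : R) (hm : 0 < m) (hmL : m <= L) :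
  forall alg : algorithm R,
    (rho_sec m L (GD (m / L ^+ 2)) <= rho_sec m L alg)%E.
Proof.
move=> alg.
have L0 : 0 < L := lt_le_trans hm hmL.
apply: le_ereal_inf => _ [rho [rho0 cert] <-]; exists rho => //; split => //.
by apply: gradient_certifies => //; exact: certified_rate_ge cert.
Qed.
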